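(* Assume: (1) for all $x\in\mathcal X_0$ there is no $s=(s_1,\dots,s_M)\in\mathcal S$ such that $\mathcal Y_s(x)=\emptyset$ while $\mathcal Y_i(x_i)\cap\mathcal Y_i^{(s_i)}\ne\emptyset$ for all $i\in\mathcal M$; (2) $T_{\mathrm{ADMM}}\to\infty$; (3) for all $i\in\mathcal M$ the pairs $(A_i^{(l)},B_i^{(l)})$, $l\in\mathcal L_i$, are controllable, the gains $K_i^{(l)}$ are such that $A_i^{(l)}+B_i^{(l)}K_i^{(l)}$ is Schur, and the origin is an equilibrium with zero input and zero neighboring states, i.e. $c_i^{(l)}=0$ for all $l\in\hat{\mathcal L}_i$; (4) for all $i\in\mathcal M$ the terminal set $\mathcal X_{\mathrm T,i}\subseteq\bigcup_{l\in\hat{\mathcal L}_i}P_i^{(l)}$ is non-empty, contains the origin, and for all $x_i\in\mathcal X_{\mathrm T,i}$, with $u_i=K_i^{(l)}x_i$ for $x_i\in P_i^{(l)}$, one has $u_i\in\mathcal U_i$ and $f_i(x_i,u_i,\{x_j\}_{j\in\mathcal N_i})\in\mathcal X_{\mathrm T,i}$ for all $x_j\in\mathcal X_{\mathrm T,j}$, $j\in\mathcal N_i$; (5) $\ell_i(x_i,u_i,\{x_j\}_{j\in\mathcal N_i})=x_i^\top Q_ix_i+u_i^\top R_iu_i+\sum_{j\in\mathcal N_i}x_j^\top Q_{ij}x_j$ and $V_{\mathrm f,i}(x_i)=x_i^\top\Phi_ix_i$ with $Q_i,R_i,\Phi_i$ positive definite, and for all $x\in\mathcal X_{\mathrm T}$,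 with $u_i=K_i^{(l)}x_i$ for $x_i\in P_i^{(l)}$, $$\sum_{i\in\mathcal M}\Big(V_{\mathrm f,i}\big(f_i(x_i,u_i,\{x_j\}_{j\in\mathcal N_i})\big)-V_{\mathrm f,i}(x_i)+\ell_i(x_i,u_i,\{x_j\}_{j\in\mathcal N_i})\Big)\le0;$$ (6) a weakly feasible set of control sequences is known for the first time step. Then, for an initial state $x\in\mathcal X_0\setminus\mathcal X_{\mathrm T}$ at time step $t=0$, a weakly feasible set of initial control guesses $\{\hat{\mathbf u}_i\}_{i\in\mathcal M}$, and control inputs generated by the stabilizing distributed MPC algorithm, the optimal control problem $\mathcal P_{\mathrm d}(x)$ is feasible (i.e. $\mathcal Y(x)\neq\emptyset$ for the current state $x$) for all time steps $t\ge0$ in which $x\notin\mathcal X_{\mathrm T}$.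
   Context: System. $\mathcal M=\{1,\dots,M\}$, $\mathcal K=\{0,\dots,N-1\}$, $\mathcal K'=\{0,\dots,N\}$, where $N$ is the prediction horizon. $\mathcal G=(\mathcal M,\mathcal E)$ is a directed graph without self-loops and $\mathcal N_i=\{j\in\mathcal M: (j,i)\in\mathcal E,\ j\ne i\}$. Subsystem $i$ has state $x_i\in\mathcal X_i\subseteq\mathbb R^{n_i}$ and input $u_i\in\mathcal U_i\subseteq\mathbb R^{m_i}$, with $\mathcal X_i,\mathcal U_i$ convex. Finitely many convex polytopes $P_i^{(l)}$, $l\in\mathcal L_i=\{1,\dots,L_i\}$ (the regions), have pairwise non-overlapping interiors and form a partition of $\mathcal X_i$; $\overline P_i^{(l)}$ is the closure and $\hat{\mathcal L}_i=\{l\in\mathcal L_i:0\in\overline P_i^{(l)}\}$. With matrices $A_i^{(l)},B_i^{(l)},A_{ij}^{(l)}$ and vectors $c_i^{(l)}$, put $f_i^{(l)}(x_i,u_i,\{x_j\}_{j\in\mathcal N_i})=A_i^{(l)}x_i+B_i^{(l)}u_i+c_i^{(l)}+\sum_{j\in\mathcal N_i}A_{ij}^{(l)}x_j$. The piecewise affine dynamics are $x_i^+=f_i(x_i,u_i,\{x_j\}_{j\in\mathcal N_i})=f_i^{(l)}(x_i,u_i,\{x_j\}_{j\in\mathcal N_i})$ if $x_i\in P_i^{(l)}$. The functions $h_i$ are linear (vector-valued), and the stage and terminal costs $\ell_i$, $V_{\mathrm f,i}$ are convex; put $F_i(\mathbf x_i,\mathbf u_i,\{\mathbf x_j\}_{j\in\mathcal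 N_i})=\sum_{k\in\mathcal K}\ell_i(x_i(k),u_i(k),\{x_j(k)\}_{j\in\mathcal N_i})+V_{\mathrm f,i}(x_i(N))$. Terminal sets $\mathcal X_{\mathrm T,i}$ and terminal gains $K_i^{(l)}$ are given; $\mathcal X_{\mathrm T}=\{x: x_i\in\mathcal X_{\mathrm T,i}\ \forall i\in\mathcal M\}$. Decision variables. $\mathbf x_i=(x_i(0),\dots,x_i(N))$, $\mathbf u_i=(u_i(0),\dots,u_i(N-1))$, and for $j\in\mathcal N_i$ a local copy $\mathbf x_j^{(i)}$ held by $i$ of subsystem $j$'s trajectory. $\tilde{\mathbf x}_i$ stacks $\mathbf x_i$ and $\mathbf x_j^{(i)}$, $j\in\mathcal N_i$; $\mathbf y_i=(\tilde{\mathbf x}_i^\top,\mathbf u_i^\top)^\top$; $\mathbf y$ collects all $\mathbf y_i$. Feasible sets. For a global state $x=(x_1,\dots,x_M)$: - $\mathcal Y_i(x_i)$: all $\mathbf y_i$ with $h_i(x_i(k),\{x_j^{(i)}(k)\}_{j\in\mathcal N_i})\le0$ and $x_i(k)\in\mathcal X_i$ for $k\in\mathcal K'$, $u_i(k)\in\mathcal U_i$ for $k\in\mathcal K$, $x_i(0)=x_i$, and $x_i(N)\in\mathcal X_{\mathrm T,i}$. - For $s_i=(s_i(0),\dots,s_i(N))\in\mathcal S_i=\{1,\dots,L_i\}^{N+1}$, $\mathcal Y_i^{(s_i)}$: all $\mathbf y_i$ with $x_i(k+1)=f_i^{(s_i(k))}(x_i(k),u_i(k),\{x_j^{(i)}(k)\}_{j\in\mathcal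 N_i})$ for $k\in\mathcal K$ and $x_i(k)\in P_i^{(s_i(k))}$ for $k\in\mathcal K'$. - For $s\in\mathcal S=\mathcal S_1\times\dots\times\mathcal S_M$, $\mathcal Y_s(x)$: all $\mathbf y$ with $\mathbf y_i\in\mathcal Y_i(x_i)\cap\mathcal Y_i^{(s_i)}$ for all $i$ and $\mathbf x_j^{(i)}=\mathbf x_j$ for all $i$, $j\in\mathcal N_i$. - $\mathcal Y(x)$: all $\mathbf y$ with $\mathbf y_i\in\mathcal Y_i(x_i)$, $x_i(k+1)=f_i(x_i(k),u_i(k),\{x_j^{(i)}(k)\}_{j\in\mathcal N_i})$ for $k\in\mathcal K$, and $\mathbf x_j^{(i)}=\mathbf x_j$, for all $i$, $j\in\mathcal N_i$. - $\mathcal P_{\mathrm d}(x)$: minimize $\sum_{i\in\mathcal M}F_i(\mathbf x_i,\mathbf u_i,\{\mathbf x_j^{(i)}\}_{j\in\mathcal N_i})$ over $\mathbf y\in\mathcal Y(x)$. $\mathcal X_0=\{x:\mathcal Y(x)\ne\emptyset\}$. Switching evaluation. $\mathrm{ES}_i(x_i,\mathbf u_i,\{\mathbf x_j^{(i)}\}_{j\in\mathcal N_i})\subseteq\mathcal S_i$ is the set of all sequences obtained by rolling out and branching: start with $\xi(0)=x_i$; for $k=0,\dots,N$, for every $l$ with $\xi(k)\in\overline P_i^{(l)}$ create a branch with $s_i(k)=l$ and (if $k<N$) $\xi(k+1)=f_i^{(l)}(\xi(k),u_i(k),\{x_j^{(i)}(k)\}_{j\in\mathcal N_i})$; if there is no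 such $l$, put $s_i(k)=1$ and keep $\xi$ unchanged. Rollout. For a state $x$ and control sequences $\{\hat{\mathbf u}_i\}$, the rollout is the trajectory $x_i(0)=x_i$, $x_i(k+1)=f_i(x_i(k),\hat u_i(k),\{x_j(k)\}_{j\in\mathcal N_i})$, with copies $\mathbf x_j^{(i)}=\mathbf x_j$. It yields $\mathbf y_{i,\mathrm{dr}}$ (trajectory, copies, and $\hat{\mathbf u}_i$) and the local cost $F_{i,\mathrm{dr}}$, the value of $F_i$ on $\mathbf y_{i,\mathrm{dr}}$. Switching ADMM procedure (inputs $x$, $\{\hat{\mathbf u}_i\}$, and the copies given by the rollout). Parameters: $\rho>0$, finite cut-off $T_{\mathrm{cut}}$, number of iterations $T_{\mathrm{ADMM}}$. Initialize $\mathbf z_i^0=0$, $\boldsymbol\lambda_i^0=0$, compute $S_i=\mathrm{ES}_i(x_i,\hat{\mathbf u}_i,\{\mathbf x_j^{(i)}\}_{j\in\mathcal N_i})$ and choose $s_i\in S_i$. Let $\tilde{\mathbf z}_i$ stack $\mathbf z_i$ and $\mathbf z_j$, $j\in\mathcal N_i$. For $\tau=0,\dots,T_{\mathrm{ADMM}}-1$, all $i\in\mathcal M$ perform: 1. $\mathbf y_i^{\tau+1}=\operatorname{argmin}_{\mathbf y_i\in\mathcal Y_i(x_i)\cap\mathcal Y_i^{(s_i)}}\ F_i(\mathbf x_i,\mathbf u_i,\{\mathbf x_j^{(i)}\}_{j\in\mathcal N_i})+(\boldsymbol\lambda_i^\tau)^\top\tilde{\mathbf x}_i+\tfrac\rho2\|\tilde{\mathbf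 x}_i-\tilde{\mathbf z}_i^\tau\|_2^2$; 2. $\mathbf z_i^{\tau+1}$ is the average of $\mathbf x_i^{\tau+1}$ and of all copies $\mathbf x_i^{(j),\tau+1}$ held by the subsystems $j$ with $i\in\mathcal N_j$; 3. $\boldsymbol\lambda_i^{\tau+1}=\boldsymbol\lambda_i^\tau+\rho(\tilde{\mathbf x}_i^{\tau+1}-\tilde{\mathbf z}_i^{\tau+1})$; 4. if $\tau<T_{\mathrm{cut}}$: compute $S_i=\mathrm{ES}_i(x_i,\mathbf u_i^{\tau+1},\{\mathbf x_j^{(i),\tau+1}\}_{j\in\mathcal N_i})$ and, if $S_i\setminus\{s_i\}\ne\emptyset$, replace $s_i$ by an element of $S_i\setminus\{s_i\}$. Output: $\{\mathbf y_i^{T_{\mathrm{ADMM}}}\}_{i\in\mathcal M}$; with $T_{\mathrm{ADMM}}\to\infty$ the output is understood as the limit. Weak feasibility. $\{\hat{\mathbf u}_i\}_{i\in\mathcal M}$ is weakly feasible for $x$ if the initial global switching sequence $s$ selected in the initialization of the switching ADMM procedure (from the rollout copies) satisfies $\mathcal Y_s(x)\ne\emptyset$. Stabilizing distributed MPC algorithm (executed at each time step $t$ with measured state $x$). If $x\in\mathcal X_{\mathrm T}$, apply $u_i=K_i^{(l)}x_i$, $x_i\in P_i^{(l)}$, for all $i$. Otherwise: (a) at the first time step let $\{\hat{\mathbf u}_i\}$ be the known weakly feasible guess; at later time steps let $\hat{\mathbf u}_i=(\bar u_i(1),\dots,\bar u_i(N-1),K_i^{(l)}\bar x_i(N))$ with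 $\bar x_i(N)\in P_i^{(l)}$, where $(\bar{\mathbf x}_i,\bar{\mathbf u}_i)$ was stored at the previous step; (b) compute the rollout $\{\mathbf y_{i,\mathrm{dr}},F_{i,\mathrm{dr}}\}$; (c) compute $\{\mathbf y_i\}$ by the switching ADMM procedure from $x$, $\{\hat{\mathbf u}_i\}$ and the rollout copies; (d) unless $F_i(\mathbf x_i,\mathbf u_i,\{\mathbf x_j^{(i)}\}_{j\in\mathcal N_i})\le F_{i,\mathrm{dr}}$ for all $i\in\mathcal M$, replace $\mathbf y_i$ by $\mathbf y_{i,\mathrm{dr}}$ for all $i$; (e) store $\bar{\mathbf x}_i=\mathbf x_i$, $\bar{\mathbf u}_i=\mathbf u_i$ and apply $u_i(0)$ for all $i$. The state then evolves by $x_i^+=f_i(x_i,u_i,\{x_j\}_{j\in\mathcal N_i})$.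
   Formalization: Added, as the claim fails without them: on the terminal set the terminal law preserves h_i ≤ 0; at t=0 the ADMM output is accepted in (d) or the rollout of the guess is feasible; each ADMM limit lies in Y_i(x_i) ∩ Y_i^{(s_i)} for the final s (automatic if P, U, X_T are closed). *)

(* Defs.v *)
From HB Require Import structures.
From mathcomp Require Export all_boot all_order all_algebra.
From mathcomp Require Export all_classical all_reals all_analysis.
From mathcomp Require Export complex.

Set Implicit Arguments.
Unset Strict Implicit.
Unset Printing Implicit Defensive.

Import Order.TTheory GRing.Theory Num.Theory numFieldNormedType.Exports.

Local Open Scope classical_set_scope.
Local Open Scope ring_scope.

Section LinearAlgebra.
Context {R : realType}.

Definition dot n (a b : 'cV[R]_n) : R := (a^T *m b) 0 0.

Definition quad n (Q : 'M[R]_n) (x : 'cV[R]_n) : R := dot x (Q *m x).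

Definition pos_def n (Q : 'M[R]_n) : Prop :=
  Q^T = Q /\ forall x : 'cV[R]_n, x != 0 -> 0 < quad Q x.

Definition schur n (Q : 'M[R]_n) : Prop :=
  forall z : R[i], eigenvalue (map_mx (real_complex R) Q) z -> `|z| < 1.

Fixpoint lin_state n m (A : 'M[R]_n) (B : 'M[R]_(n, m)) (u : nat -> 'cV[R]_m)
    (x0 : 'cV[R]_n) (k : nat) : 'cV[R]_n :=
  if k is k'.+1 then A *m lin_state A B u x0 k' + B *m u k' else x0.

Definition controllable n m (A : 'M[R]_n) (B : 'M[R]_(n, m)) : Prop :=
  forall x0 x1 : 'cV[R]_n, exists (T : nat) (u : nat -> 'cV[R]_m),
    lin_state A B u x0 T = x1.

Definition convex n (S : set 'cV[R]_n) : Prop :=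
  @convex_set R 'cV[R]_n S.

(* Some faces may be missing, so that discontinuous piecewise affine maps on a
   genuine (disjoint) partition are covered; only the closure is a polytope in
   the usual sense of a bounded intersection of finitely many closed
   half-spaces. *)
Definition convex_polytope n (S : set 'cV[R]_n) : Prop :=
  [/\ convex S,
      exists b : R, forall x, S x -> forall r, `|x r 0| <= b
    & exists (p : nat) (G : 'M[R]_(p, n)) (g : 'cV[R]_p),
        closure S = [set x | forall r, (G *m x) r 0 <= g r 0]].

End LinearAlgebra.

Definition is_nbr M (e : rel 'I_M) (i j : 'I_M) : bool := e j i && (j != i).

(* [nbr e i] is N_i; [holder e i] is the set of the j with i \in N_j. *)
Notation nbr e i := {j | is_nbr e i j}.
Notation holder e i := {j | is_nbr e j i}.

(* The horizon is N = (hor D).+1, since the input u_i(0) must exist, and the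
   regions of subsystem i are indexed by 'I_(nreg i).+1, label 1 being [ord0].
   The constraint functions are linear in the sense used for constraints, i.e.
   affine: h_i = h_own x_i + \sum_j h_nbr x_j + h_off.
   [f] is a field constrained by [well_posed] below, because the region
   dynamics say nothing about its values outside of the regions. *)
Record network (R : realType) := Network {
  nsub : nat;
  hor : nat;
  edge : rel 'I_nsub;
  dimx : 'I_nsub -> nat;
  dimu : 'I_nsub -> nat;
  nreg : 'I_nsub -> nat;
  ncon : 'I_nsub -> nat;
  X : forall i, set 'cV[R]_(dimx i);
  U : forall i, set 'cV[R]_(dimu i);
  P : forall i, 'I_(nreg i).+1 -> set 'cV[R]_(dimx i);
  A : forall i, 'I_(nreg i).+1 -> 'M[R]_(dimx i);
  B : forall i, 'I_(nreg i).+1 -> 'M[R]_(dimx i, dimu i);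
  c : forall i, 'I_(nreg i).+1 -> 'cV[R]_(dimx i);
  Anb : forall i, 'I_(nreg i).+1 ->
    forall j : nbr edge i, 'M[R]_(dimx i, dimx (sval j));
  f : forall i, 'cV[R]_(dimx i) -> 'cV[R]_(dimu i) ->
    (forall j : nbr edge i, 'cV[R]_(dimx (sval j))) -> 'cV[R]_(dimx i);
  h_own : forall i, 'M[R]_(ncon i, dimx i);
  h_nbr : forall i (j : nbr edge i), 'M[R]_(ncon i, dimx (sval j));
  h_off : forall i, 'cV[R]_(ncon i);
  ell : forall i, 'cV[R]_(dimx i) -> 'cV[R]_(dimu i) ->
    (forall j : nbr edge i, 'cV[R]_(dimx (sval j))) -> R;
  Vf : forall i, 'cV[R]_(dimx i) -> R;
  XT : forall i, set 'cV[R]_(dimx i);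
  K : forall i, 'I_(nreg i).+1 -> 'M[R]_(dimu i, dimx i)
}.

Arguments edge {R n}.
Arguments X {R n} i.
Arguments U {R n} i.
Arguments XT {R n} i.

Section MPC.
Context {R : realType} (D : network R).

Notation sub := 'I_(nsub D).
Notation N := (hor D).+1.

Implicit Types i : sub.

Definition nbr_state i : Type :=
  forall j : nbr edge i, 'cV[R]_(dimx (sval j)).

Definition state : Type := forall i, 'cV[R]_(dimx i).

Definition inputs : Type := forall i, 'I_N -> 'cV[R]_(dimu i).

Definition labels : Type := forall i, 'I_(nreg i).+1.

Definition nbrs (x : state) i : nbr_state i := fun j => x (sval j).
Arguments nbrs : clear implicits.

Definition f_reg i (l : 'I_(nreg i).+1) (x : 'cV[R]_(dimx i))
    (u : 'cV[R]_(dimu i)) (xn : nbr_state i) : 'cV[R]_(dimx i) :=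
  A l *m x + B l *m u + c l + \sum_j Anb l j *m xn j.

Definition h i (x : 'cV[R]_(dimx i)) (xn : nbr_state i) : 'cV[R]_(ncon i) :=
  h_own i *m x + \sum_j h_nbr j *m xn j + h_off i.

Definition h_le0 i (x : 'cV[R]_(dimx i)) (xn : nbr_state i) : Prop :=
  forall r, (h x xn) r 0 <= 0.

(* The neighbour arguments form a dependent family, which is not an lmodType of
   the library, hence the explicit joint convexity of [ell]. *)
Definition convex_stage_cost i : Prop :=
  forall (t : R) (x x' : 'cV[R]_(dimx i)) (u u' : 'cV[R]_(dimu i))
         (xn xn' : nbr_state i),
    0 <= t <= 1 ->
    ell (t *: x + (1 - t) *: x') (t *: u + (1 - t) *: u')
        (fun j => t *: xn j + (1 - t) *: xn' j)
    <= t * ell x u xn + (1 - t) * ell x' u' xn'.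

Definition convex_terminal_cost i : Prop :=
  @convex_function R 'cV[R]_(dimx i) setT (@Vf R D i).

(* Regions may share boundary points provided that f_i is a function, i.e. that
   the affine maps agree there; for disjoint regions the last clause is just
   the definition of f_i on X_i. *)
Record well_posed : Prop := WellPosed {
  wp_loopless : forall i, ~~ edge i i;
  wp_X : forall i, convex (X i);
  wp_U : forall i, convex (U i);
  wp_P : forall i (l : 'I_(nreg i).+1), convex_polytope (P l);
  wp_interior : forall i (l l' : 'I_(nreg i).+1), l != l' ->
    interior (P l) `&` interior (P l') = set0;
  wp_cover : forall i, \bigcup_(l in [set: 'I_(nreg i).+1]) P l = X i;
  wp_f : forall i (l : 'I_(nreg i).+1) x u (xn : nbr_state i),
    P l x -> f x u xn = f_reg l x u xn;
  wp_ell : forall i, convex_stage_cost i;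
  wp_Vf : forall i, convex_terminal_cost i
}.

Definition in_region (x : state) (l : labels) : Prop :=
  forall i, P (l i) (x i).

Definition XTg : set state := [set x | forall i, XT i (x i)].

Definition Lhat i : set 'I_(nreg i).+1 := [set l | closure (P l) 0].
Arguments Lhat : clear implicits.

Definition traj i : Type := 'I_N.+1 -> 'cV[R]_(dimx i).

Definition now (k : 'I_N) : 'I_N.+1 := widen_ord (leqnSn N) k.
Definition next (k : 'I_N) : 'I_N.+1 := lift ord0 k.

(* The shape of \tilde x_i: an own trajectory and one for each neighbour. *)
Record stack i := Stack {
  own : traj i;
  copy : forall j : nbr edge i, traj (sval j)
}.

Record local_dec i := LocalDec {
  xt : stack i;
  us : 'I_N -> 'cV[R]_(dimu i)
}.

Definition decision : Type := forall i, local_dec i.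

Definition xs i (y : local_dec i) : traj i := own (xt y).

Definition copies i (y : local_dec i) (k : 'I_N.+1) : nbr_state i :=
  fun j => copy (xt y) j k.

Definition switching i : Type := {ffun 'I_N.+1 -> 'I_(nreg i).+1}.

Definition cost i (y : local_dec i) : R :=
  \sum_(k < N) ell (xs y (now k)) (us y k) (copies y (now k))
  + Vf (xs y ord_max).

Definition Yloc i (xi : 'cV[R]_(dimx i)) : set (local_dec i) :=
  [set y | [/\ forall k, h_le0 (xs y k) (copies y k) /\ X i (xs y k),
               forall k, U i (us y k),
               xs y ord0 = xi
             & XT i (xs y ord_max)]].

Definition Ysw i (s : switching i) : set (local_dec i) :=
  [set y | (forall k, xs y (next k)
              = f_reg (s (now k)) (xs y (now k)) (us y k) (copies y (now k)))
           /\ forall k, P (s k) (xs y k)].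

Definition consensus (y : decision) : Prop :=
  forall i (j : nbr edge i), copy (xt (y i)) j = xs (y (sval j)).

Definition Ys (s : forall i, switching i) (x : state) : set decision :=
  [set y | (forall i, (Yloc (x i) `&` Ysw (s i)) (y i)) /\ consensus y].

Definition dynamics (y : decision) : Prop :=
  forall i k, xs (y i) (next k)
    = f (xs (y i) (now k)) (us (y i) k) (copies (y i) (now k)).

Definition Y (x : state) : set decision :=
  [set y | [/\ forall i, Yloc (x i) (y i), dynamics y & consensus y]].

Definition X0 : set state := [set x | Y x !=set0].

Definition ES i (xi : 'cV[R]_(dimx i)) (y : local_dec i) :
    set (switching i) :=
  [set s | exists2 xi_ : traj i, xi_ ord0 = xi &
    (forall k, if `[< exists l, closure (P l) (xi_ k) >]
       then closure (P (s k)) (xi_ k) else s k = ord0)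
    /\ (forall k, xi_ (next k) =
         if `[< exists l, closure (P l) (xi_ (now k)) >]
         then f_reg (s (now k)) (xi_ (now k)) (us y k) (copies y (now k))
         else xi_ (now k))].

Definition rollout (x : state) (uh : inputs) (y : decision) : Prop :=
  [/\ forall i, xs (y i) ord0 = x i,
      forall i, us (y i) = uh i,
      dynamics y
    & consensus y].

Definition stack0 i : stack i := Stack (fun=> 0) (fun j k => 0).

Definition stack_of (z : forall i, traj i) i : stack i :=
  Stack (z i) (fun j => z (sval j)).

Definition stack_add i (a b : stack i) : stack i :=
  Stack (fun k => own a k + own b k) (fun j k => copy a j k + copy b j k).

Definition stack_scale i (t : R) (a : stack i) : stack i :=
  Stack (fun k => t *: own a k) (fun j k => t *: copy a j k).

Definition stack_sub i (a b : stack i) : stack i :=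
  stack_add a (stack_scale (- 1) b).

Definition stack_dot i (a b : stack i) : R :=
  \sum_k dot (own a k) (own b k) + \sum_j \sum_k dot (copy a j k) (copy b j k).

Definition aug_cost (rho : R) i (lam zt : stack i) (y : local_dec i) : R :=
  cost y + stack_dot lam (xt y)
  + rho / 2 * stack_dot (stack_sub (xt y) zt) (stack_sub (xt y) zt).

Definition is_argmin T (S : set T) (F : T -> R) (y : T) : Prop :=
  S y /\ forall y', S y' -> F y <= F y'.

Definition held_copy (y : decision) i (j : holder edge i) : traj i :=
  copy (xt (y (sval j))) (exist _ i (svalP j)).

Definition average (y : decision) i : traj i := fun k =>
  (#|{: holder edge i}|.+1%:R)^-1 *:
    (xs (y i) k + \sum_(j : holder edge i) held_copy y j k).

(* Iterates indexed by tau; [it_y 0] is not used. *)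
Record iterates := Iterates {
  it_y : nat -> decision;
  it_z : nat -> forall i, traj i;
  it_lam : nat -> forall i, stack i;
  it_s : nat -> forall i, switching i
}.

Definition switch_update i (S : set (switching i)) (s s' : switching i) : Prop :=
  if `[< S `\ s !=set0 >] then (S `\ s) s' else s' = s.

(* [y0] is the decision variable from which the initial inputs and copies are
   taken, namely the rollout. *)
Definition admm (rho : R) (Tcut : nat) (x : state) (y0 : decision)
    (H : iterates) : Prop :=
  [/\ forall i, [/\ it_z H 0 i = (fun=> 0), it_lam H 0 i = stack0 i
                  & ES (x i) (y0 i) (it_s H 0 i)],
      forall tau i,
        is_argmin (Yloc (x i) `&` Ysw (it_s H tau i))
          (aug_cost rho (it_lam H tau i) (stack_of (it_z H tau) i))
          (it_y H tau.+1 i),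
      forall tau i, it_z H tau.+1 i = average (it_y H tau.+1) i,
      forall tau i, it_lam H tau.+1 i =
        stack_add (it_lam H tau i)
          (stack_scale rho
             (stack_sub (xt (it_y H tau.+1 i)) (stack_of (it_z H tau.+1) i)))
    & forall tau i,
        if (tau < Tcut)%N
        then switch_update (ES (x i) (it_y H tau.+1 i))
               (it_s H tau i) (it_s H tau.+1 i)
        else it_s H tau.+1 i = it_s H tau i].

(* The output of the procedure for T_ADMM -> oo. *)
Definition admm_limit (H : iterates) (y : decision) : Prop :=
  forall i,
    [/\ forall k, (fun tau => xs (it_y H tau i) k) @ \oo --> xs (y i) k,
        forall j k,
          (fun tau => copy (xt (it_y H tau i)) j k) @ \oo --> copy (xt (y i)) j k
      & forall k, (fun tau => us (it_y H tau i) k) @ \oo --> us (y i) k].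

(* Here s is the initial switching sequence that the procedure selects. *)
Definition weakly_feasible (x : state) (uh : inputs)
    (s : forall i, switching i) : Prop :=
  (exists2 y, rollout x uh y & forall i, ES (x i) (y i) (s i))
  /\ Ys s x !=set0.

(* Signals indexed by the time step; all but [st] and [inp] are meaningful only
   at the steps where the state is outside of the terminal set. *)
Record closed_loop := ClosedLoop {
  st : nat -> state;
  inp : nat -> forall i, 'cV[R]_(dimu i);
  guess : nat -> inputs;
  roll : nat -> decision;
  iters : nat -> iterates;
  out : nat -> decision;
  plan : nat -> decision
}.

Definition terminal_input (x : state) (u : forall i, 'cV[R]_(dimu i)) : Prop :=
  exists2 l : labels, in_region x l & forall i, u i = K (l i) *m x i.

Definition shifted (ybar : decision) (uh : inputs) : Prop :=
  forall i,
    (forall k k' : 'I_N, k' = k.+1 :> nat -> uh i k = us (ybar i) k')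
    /\ exists2 l, P l (xs (ybar i) ord_max)
                & uh i ord_max = K l *m xs (ybar i) ord_max.

Definition accepted (ydr y : decision) : Prop :=
  forall i, cost (y i) <= cost (ydr i).

Definition mpc_step (rho : R) (Tcut : nat) (C : closed_loop) (t : nat) : Prop :=
  [/\ XTg (st C t) -> terminal_input (st C t) (inp C t),
      ~ XTg (st C t) ->
        [/\ (if t is t'.+1 then shifted (plan C t') (guess C t) else True),
            rollout (st C t) (guess C t) (roll C t),
            admm rho Tcut (st C t) (roll C t) (iters C t)
              /\ admm_limit (iters C t) (out C t),
            plan C t = (if `[< accepted (roll C t) (out C t) >]
                        then out C t else roll C t)
          & forall i, inp C t i = us (plan C t i) ord0]
    & forall i, st C t.+1 i = f (st C t i) (inp C t i) (nbrs (st C t) i)].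

Definition no_false_local_feasibility : Prop :=
  forall x, X0 x -> ~ exists s : forall i, switching i,
    Ys s x = set0 /\ forall i, Yloc (x i) `&` Ysw (s i) !=set0.

Definition linear_parts_ok : Prop :=
  forall i,
    [/\ forall l : 'I_(nreg i).+1, controllable (A l) (B l),
        forall l : 'I_(nreg i).+1, schur (A l + B l *m K l)
      & forall l, Lhat i l -> c l = 0].

Definition terminal_sets_ok : Prop :=
  forall i,
    [/\ XT i `<=` \bigcup_(l in Lhat i) P l,
        XT i !=set0,
        XT i 0
      & forall x (l : 'I_(nreg i).+1), XT i x -> P l x ->
          U i (K l *m x) /\
          forall xn : nbr_state i,
            (forall j, XT (sval j) (xn j)) -> XT i (f x (K l *m x) xn)].

Definition quadratic_costs : Prop :=
  exists (Q Phi : forall i, 'M[R]_(dimx i)) (Ru : forall i, 'M[R]_(dimu i))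
         (Qn : forall i (j : nbr edge i), 'M[R]_(dimx (sval j))),
  forall i,
    [/\ pos_def (Q i), pos_def (Ru i), pos_def (Phi i),
        forall x u (xn : nbr_state i),
          ell x u xn = quad (Q i) x + quad (Ru i) u + \sum_j quad (Qn i j) (xn j)
      & forall x : 'cV[R]_(dimx i), Vf x = quad (Phi i) x].

Definition terminal_decrease : Prop :=
  forall (x : state) (l : labels), XTg x -> in_region x l ->
    \sum_i (Vf (f (x i) (K (l i) *m x i) (nbrs x i)) - Vf (x i)
            + ell (x i) (K (l i) *m x i) (nbrs x i)) <= 0.

(* The invariance of the terminal sets says nothing about the constraints h_i,
   which the shifted plan must satisfy at its new last state. *)
Definition terminal_coupling : Prop :=
  forall (x : state) (l : labels), XTg x -> in_region x l ->
    (forall i, h_le0 (x i) (nbrs x i)) ->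
    let x' : state := fun i => f (x i) (K (l i) *m x i) (nbrs x i) in
    forall i, h_le0 (x' i) (nbrs x' i).

(* The limit of the iterates stays in the sets over which they are computed.
   This is automatic when the sets P, U and XT are closed; the switching
   sequence is constant from iteration Tcut on. *)
Definition limit_admissible (Tcut : nat) (C : closed_loop) (t : nat) : Prop :=
  ~ XTg (st C t) ->
  forall i, (Yloc (st C t i) `&` Ysw (it_s (iters C t) Tcut i)) (out C t i).

(* The algorithm may replace the output by the rollout of the initial guess, and
   weak feasibility alone does not make this rollout feasible. *)
Definition initial_fallback_feasible (C : closed_loop) : Prop :=
  accepted (roll C 0) (out C 0) \/ Y (st C 0) (roll C 0).

End MPC.

(* Main.v *)
Require Import Defs.
From mathcomp Require Import zify lra.

(** The proof shows that the plan stored at each step outside of the terminal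
    set is feasible for the current state.  Feasibility then propagates in the
    usual way: dropping the first input of a feasible plan and appending the
    terminal feedback gives inputs whose rollout from the next state retraces
    the old plan and makes one more step inside the terminal sets, which are
    invariant ([shifted_rollout_feasible]).  This settles recursive feasibility
    ([next_state_feasible]) and also the case in which the algorithm falls back
    on the rollout.

    The other case is an accepted output of the switching ADMM procedure.  That
    output respects the local constraints of a fixed switching sequence, so
    what is missing is consensus, i.e. that the copies agree with the
    trajectories they stand for ([admm_limit_consensus]).  Write r^t for the
    residual (stacked trajectories minus stacked averages) and lam^t for the
    multipliers, so that lam^(t+1) = lam^t + rho r^(t+1).  The iterates
    converge, hence r^t has a limit r, and consensus means r = 0.
    - Averaging makes every residual, hence every multiplier, orthogonal to all
      consensual stacks ([residual_orthogonal], [admm_dual_orthogonal]).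
    - The exclusion of false local feasibility provides a consensual competitor
      for the local minimizations.  Comparing with it and cancelling by
      orthogonality bounds <lam^t, r^(t+1)> from above by a convergent sequence
      ([admm_dual_dot_residual]).
    - But lam^t is rho times the sum of the first t residuals, so
      <lam^t, r^(t+1)> grows like rho t |r|^2 unless r = 0
      ([summands_limit_le0]). *)

Set Implicit Arguments.
Unset Strict Implicit.
Unset Printing Implicit Defensive.

Import Order.TTheory GRing.Theory Num.Theory numFieldNormedType.Exports.

Local Open Scope classical_set_scope.
Local Open Scope ring_scope.

#[local] Arguments nbrs {R D} x i _ : rename.

(** * Growth of sums of almost constant terms *)

Section ScalarGrowth.
Context {R : realType}.

Lemma cvg_sumf (T : Type) (F : set_system T) {FF : Filter F} (I : finType)
    (f : I -> T -> R) (l : I -> R) :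
  (forall i, f i t @[t --> F] --> l i) ->
  \sum_i f i t @[t --> F] --> \sum_i l i.
Proof. by move=> fl; apply: cvg_big => // -[a b]; apply: add_continuous. Qed.

(** In the application [g k m] is <r^k, r^m> and [L t m] is <lam^t, r^m>.  Were
    [d] positive, all the increments of [L] in [t] would eventually exceed
    [rho * (d / 2)], for all [m] at once, so that the diagonal of [L] would grow
    linearly.  The growth starts from a row [L T], which is bounded below since it
    converges. *)
Lemma summands_limit_le0 (rho d beta : R) (L g : nat -> nat -> R)
    (b : nat -> R) :
  0 < rho -> (forall t m, L t.+1 m = L t m + rho * g t.+1 m) ->
  (forall t, cvgn (L t)) ->
  g p.1 p.2 @[p --> (\oo, \oo)] --> d ->
  b @ \oo --> beta -> (\forall t \near \oo, L t t.+1 <= b t) ->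
  d <= 0.
Proof.
move=> rho0 LS cL gd bbeta Lb; rewrite leNgt; apply/negP => d0.
have d2 : d / 2 < d by rewrite ltr_pdivrMr // ltr_pMr // ltr1n.
have [T gT] : exists T, forall k m, (T <= k)%N -> (T <= m)%N -> d / 2 <= g k m.
  have [[P Q] /= [[n1 _ H1] [n2 _ H2]] PQ] := cvgr_ge _ gd _ d2.
  exists (maxn n1 n2) => k m; rewrite !geq_max => /andP[k1 k2] /andP[m1 m2].
  by apply: (PQ (k, m)); split; [exact: H1 | exact: H2].
(* The first [T] increments are absorbed by [L T m]. *)
have LT n m : (T <= m)%N -> L T m + n%:R * (rho * (d / 2)) <= L (T + n)%N m.
  move=> Tm; elim: n => [|n IHn]; first by rewrite mul0r addr0 addn0.
  rewrite addnS LS -natr1 mulrDl mul1r addrA lerD // ler_pM2l //.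
  by rewrite gT // -addnS leq_addr.
have e0 : 0 < rho * (d / 2) by rewrite mulr_gt0 // divr_gt0.
have /cvg_ex[/= a LTa] := cL T.
have [n1 _ bd] := cvgr_le _ bbeta _ (ltr_pwDr ltr01 (lexx beta)).
have a1 : a - 1 < a by rewrite ltrBlDr ltr_pwDr.
have [n2 _ ad] := cvgr_ge _ LTa _ a1.
have [n3 _ Lb3] := Lb.
pose r := (beta + 1 - (a - 1)) / (rho * (d / 2)).
have [n4 _ /(_ _ (leqnn _)) n4r] := @nbhs_infty_gtr R r.
(* Late enough for all the estimates, and past the crossing point [r]. *)
pose n := (n1 + n2 + n3 + n4)%N.
have rn : r < n%:R by apply: lt_le_trans n4r _; rewrite ler_nat leq_addl.
have le1 : (n1 <= T + n)%N by rewrite /n; lia.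
have le2 : (n2 <= (T + n).+1)%N by rewrite /n; lia.
have le3 : (n3 <= T + n)%N by rewrite /n; lia.
have TTn : (T <= (T + n).+1)%N by lia.
have := le_trans (LT n _ TTn) (le_trans (Lb3 _ le3) (bd _ le1)).
apply/negP; rewrite -ltNge.
apply: lt_le_trans (lerD (ad _ le2) (lexx _)).
by rewrite -ltrBlDl -ltr_pdivrMr.
Qed.
End ScalarGrowth.

(** * Inner product and convergence of stacked trajectories *)

Section StackSpace.
Context {R : realType}.

Lemma dotE n (a b : 'cV[R]_n) : dot a b = \sum_r a r 0 * b r 0.
Proof. by rewrite /dot mxE; apply: eq_bigr => r _; rewrite mxE. Qed.

Lemma dotC n (a b : 'cV[R]_n) : dot a b = dot b a.
Proof. by rewrite !dotE; apply: eq_bigr => r _; rewrite mulrC. Qed.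

Lemma dotDl n (a b v : 'cV[R]_n) : dot (a + b) v = dot a v + dot b v.
Proof. by rewrite /dot linearD mulmxDl mxE. Qed.

Lemma dotZl n t (a v : 'cV[R]_n) : dot (t *: a) v = t * dot a v.
Proof. by rewrite /dot linearZ -scalemxAl mxE. Qed.

Lemma dot_ge0 n (a : 'cV[R]_n) : 0 <= dot a a.
Proof. by rewrite dotE sumr_ge0 // => r _; rewrite -expr2 sqr_ge0. Qed.

Lemma dot_eq0 n (a : 'cV[R]_n) : dot a a = 0 -> a = 0.
Proof.
rewrite dotE => /psumr_eq0P a0; apply/colP => r; rewrite mxE.
apply/eqP; rewrite -sqrf_eq0 expr2; apply/eqP.
by apply: a0 => // s _; rewrite -expr2 sqr_ge0.
Qed.

Definition coord_cvg (T : Type) (F : set_system T) n (a : T -> 'cV[R]_n)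
    (l : 'cV[R]_n) : Prop :=
  forall r, a t r 0 @[t --> F] --> l r 0.

Lemma coord_cvgP (T : Type) (F : set_system T) {FF : Filter F} n
    (a : T -> 'cV[R]_n) (l : 'cV[R]_n) : a @ F --> l -> coord_cvg F a l.
Proof.
move=> al r; apply: (cvg_comp a (fun v : 'cV[R]_n => v r 0) al).
exact: coord_continuous.
Qed.

Lemma coord_cvg_dot (T : Type) (F : set_system T) {FF : Filter F} n
    (a b : T -> 'cV[R]_n) (l l' : 'cV[R]_n) :
  coord_cvg F a l -> coord_cvg F b l' ->
  dot (a t) (b t) @[t --> F] --> dot l l'.
Proof.
move=> al bl; rewrite dotE; under eq_cvg do rewrite dotE.
by apply: cvg_sumf => r; exact: cvgM.
Qed.

Lemma coord_cvg_quad (T : Type) (F : set_system T) {FF : Filter F} n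
    (Q : 'M[R]_n) (a : T -> 'cV[R]_n) (l : 'cV[R]_n) :
  coord_cvg F a l -> quad Q (a t) @[t --> F] --> quad Q l.
Proof.
move=> al; apply: coord_cvg_dot => // r.
rewrite mxE; under eq_cvg do rewrite mxE.
by apply: cvg_sumf => s; apply: cvgMl_tmp; exact: al.
Qed.

Context {D : network R}.
Notation sub := 'I_(nsub D).
Implicit Types (i : sub).

(** A stack is a record of dependent families, without a topology of its own:
    convergence is coordinatewise. *)
Definition stack_cvg (T : Type) (F : set_system T) i (a : T -> stack i)
    (l : stack i) : Prop :=
  (forall k, coord_cvg F (fun t => own (a t) k) (own l k)) /\
  forall j k, coord_cvg F (fun t => copy (a t) j k) (copy l j k).

Lemma stack_cvg_cst (T : Type) (F : set_system T) {FF : Filter F} i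
  (l : stack i) : stack_cvg F (fun=> l) l.
Proof. by split=> * ?; exact: cvg_cst. Qed.

Lemma stack_cvg_comp (T T' : Type) (F : set_system T) (G : set_system T')
    (p : T -> T') i (a : T' -> stack i) (l : stack i) :
  p @ F --> G -> stack_cvg G a l -> stack_cvg F (a \o p) l.
Proof.
move=> pG [oa ca]; split=> [k|j k] r.
  exact: cvg_comp pG (oa k r).
exact: cvg_comp pG (ca j k r).
Qed.

Lemma stack_cvg_add (T : Type) (F : set_system T) {FF : Filter F} i
    (a b : T -> stack i) (l l' : stack i) :
  stack_cvg F a l -> stack_cvg F b l' ->
  stack_cvg F (fun t => stack_add (a t) (b t)) (stack_add l l').
Proof.
move=> [oa ca] [ob cb]; split=> [k|j k] r /=.
  by rewrite mxE; under eq_cvg do rewrite mxE;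
    apply: cvgD; [exact: oa|exact: ob].
by rewrite mxE; under eq_cvg do rewrite mxE;
  apply: cvgD; [exact: ca|exact: cb].
Qed.

Lemma stack_cvg_scale (T : Type) (F : set_system T) {FF : Filter F} i (s : R)
    (a : T -> stack i) (l : stack i) : stack_cvg F a l ->
  stack_cvg F (fun t => stack_scale s (a t)) (stack_scale s l).
Proof.
move=> [oa ca]; split=> [k|j k] r /=.
  by rewrite mxE; under eq_cvg do rewrite mxE; apply: cvgMl_tmp; exact: oa.
by rewrite mxE; under eq_cvg do rewrite mxE; apply: cvgMl_tmp; exact: ca.
Qed.

Lemma stack_cvg_sub (T : Type) (F : set_system T) {FF : Filter F} i
    (a b : T -> stack i) (l l' : stack i) :
  stack_cvg F a l -> stack_cvg F b l' ->
  stack_cvg F (fun t => stack_sub (a t) (b t)) (stack_sub l l').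
Proof. by move=> al bl; apply: stack_cvg_add => //; exact: stack_cvg_scale. Qed.

Lemma stack_cvg_dot (T : Type) (F : set_system T) {FF : Filter F} i
    (a b : T -> stack i) (l l' : stack i) :
  stack_cvg F a l -> stack_cvg F b l' ->
  stack_dot (a t) (b t) @[t --> F] --> stack_dot l l'.
Proof.
move=> [oa ca] [ob cb]; apply: cvgD; apply: cvg_sumf => j.
  exact: coord_cvg_dot.
by apply: cvg_sumf => k; exact: coord_cvg_dot.
Qed.

Lemma stack_dotC i (a b : stack i) : stack_dot a b = stack_dot b a.
Proof.
rewrite /stack_dot; congr (_ + _).
  by apply: eq_bigr => k _; exact: dotC.
by apply: eq_bigr => j _; apply: eq_bigr => k _; exact: dotC.
Qed.

Lemma stack_dotDl i (a b v : stack i) :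
  stack_dot (stack_add a b) v = stack_dot a v + stack_dot b v.
Proof.
rewrite /stack_dot addrACA -!big_split /=; congr (_ + _).
  by apply: eq_bigr => k _; exact: dotDl.
apply: eq_bigr => j _; rewrite -big_split.
by apply: eq_bigr => k _; exact: dotDl.
Qed.

Lemma stack_dotZl i t (a v : stack i) :
  stack_dot (stack_scale t a) v = t * stack_dot a v.
Proof.
rewrite /stack_dot mulrDr !mulr_sumr; congr (_ + _).
  by apply: eq_bigr => k _; exact: dotZl.
apply: eq_bigr => j _; rewrite mulr_sumr.
by apply: eq_bigr => k _; exact: dotZl.
Qed.

Lemma stack_dotBr i (v a b : stack i) :
  stack_dot v (stack_sub a b) = stack_dot v a - stack_dot v b.
Proof. by rewrite !(stack_dotC v) stack_dotDl stack_dotZl mulN1r. Qed.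

Lemma stack_dot0l i (v : stack i) : stack_dot (stack0 i) v = 0.
Proof.
have d0 n (a : 'cV[R]_n) : dot 0 a = 0 by rewrite /dot trmx0 mul0mx mxE.
rewrite /stack_dot big1 => [|k _]; last exact: d0.
by rewrite big1 ?addr0 // => j _; rewrite big1 // => k _; exact: d0.
Qed.

Lemma stack_dot_ge0 i (a : stack i) : 0 <= stack_dot a a.
Proof.
apply: addr_ge0; apply: sumr_ge0 => j _; first exact: dot_ge0.
by apply: sumr_ge0 => k _; exact: dot_ge0.
Qed.

Lemma stack_sub_dot_eq0 i (a b : stack i) :
  stack_dot (stack_sub a b) (stack_sub a b) = 0 -> a = b.
Proof.
set v := stack_sub a b => v0.
have d0 j k : 0 <= dot (copy v j k) (copy v j k) by exact: dot_ge0.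
have o0 k : 0 <= dot (own v k) (own v k) by exact: dot_ge0.
have S0 j : 0 <= \sum_k dot (copy v j k) (copy v j k) by exact: sumr_ge0.
move/eqP: v0; rewrite paddr_eq0 ?sumr_ge0 // => /andP[/eqP v1 /eqP v2].
case: a b @v d0 o0 S0 v1 v2 => [oa ca] [ob cb] v d0 o0 S0 v1 v2.
have eq_of_sub n (x z : 'cV[R]_n) : x + -1 *: z = 0 -> x = z.
  by rewrite scaleN1r => /subr0_eq.
congr Stack.
  apply/funext => k; apply/eq_of_sub/dot_eq0.
  exact: (psumr_eq0P (fun k _ => o0 k) v1).
apply: functional_extensionality_dep => j.
apply/funext => k; apply/eq_of_sub/dot_eq0.
have v2j : \sum_k dot (copy v j k) (copy v j k) = 0.
  exact: (psumr_eq0P (fun j _ => S0 j) v2).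
exact: (psumr_eq0P (fun k _ => d0 j k) v2j).
Qed.

End StackSpace.

(** * The limit of the ADMM iterates is a consensus *)

Section Consensus.
Context {R : realType} {D : network R}.
Notation sub := 'I_(nsub D).
Implicit Types (i : sub) (y : decision D).

Definition stacks : Type := forall i, stack i.

Definition stacks_dot (a b : stacks) : R := \sum_i stack_dot (a i) (b i).

Definition residual y : stacks :=
  fun i => stack_sub (xt (y i)) (stack_of (average y) i).

Lemma sum_nbr_holder (F : forall i (j : nbr edge i), R) :
  \sum_i \sum_(j : nbr edge i) F i j =
  \sum_i \sum_(j : holder edge i) F (sval j) (exist _ i (svalP j)).
Proof.
rewrite !sig_big_dep /=.
pose h (p : {i : sub & holder edge i}) : {i : sub & nbr edge i} :=
  existT _ (sval (tagged p)) (exist _ (tag p) (svalP (tagged p))).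
pose h' (p : {i : sub & nbr edge i}) : {i : sub & holder edge i} :=
  existT _ (sval (tagged p)) (exist _ (tag p) (svalP (tagged p))).
rewrite (reindex h) //; exists h'.
  by case=> i [j e] _; congr existT; exact: val_inj.
by case=> i [j e] _; congr existT; exact: val_inj.
Qed.

(** Regrouping by the subsystem [i] that the entries describe, [w i] is paired
    with the sum, over the trajectory of [i] and all its copies, of the
    deviations from their average, and this sum is zero. *)
Lemma residual_orthogonal y (w : forall i, traj i) :
  stacks_dot (residual y) (stack_of w) = 0.
Proof.
rewrite /stacks_dot /stack_dot big_split /= sum_nbr_holder -big_split /=.
apply: big1 => i _; rewrite exchange_big -big_split /=; apply: big1 => k _.
set z := average y i k.
pose m := #|{: holder edge i}|.
have dotB n (a b v : 'cV[R]_n) : dot (a + -1 *: b) v = dot a v - dot b v.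
  by rewrite dotDl dotZl mulN1r.
have avg : m.+1%:R * dot z (w i k) =
    dot (xs (y i) k) (w i k) +
    \sum_(j : holder edge i) dot (held_copy y j k) (w i k).
  rewrite -dotZl /z /average scalerA divff ?pnatr_eq0 // scale1r dotDl.
  by congr (_ + _); rewrite /dot linear_sum mulmx_suml summxE.
rewrite dotB (eq_bigr (fun j => dot (held_copy y j k) (w i k) - dot z (w i k))).
  rewrite sumrB sumr_const addrACA -avg -opprD.
  by rewrite -mulrS mulr_natl subrr.
by move=> j _; rewrite dotB.
Qed.

Lemma consensus_stack_of y : consensus y ->
  forall i, xt (y i) = stack_of (fun j => xs (y j)) i.
Proof.
move=> cy i; transitivity (Stack (own (xt (y i))) (copy (xt (y i)))).
  by case: (xt (y i)).
by congr Stack; apply: functional_extensionality_dep => j; exact: cy.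
Qed.

Lemma residual0_consensus y :
  stacks_dot (residual y) (residual y) = 0 -> consensus y.
Proof.
move=> r0.
have e i : xt (y i) = stack_of (average y) i.
  apply: stack_sub_dot_eq0.
  by apply: (psumr_eq0P _ r0) => // j _; exact: stack_dot_ge0.
by move=> i j; rewrite /xs !e.
Qed.

Definition decision_cvg (T : Type) (F : set_system T) (ys : T -> decision D)
    y : Prop :=
  forall i, stack_cvg F (fun t => xt (ys t i)) (xt (y i)) /\
    forall k, coord_cvg F (fun t => us (ys t i) k) (us (y i) k).

Lemma admm_limit_cvg H y : admm_limit H y -> decision_cvg \oo (it_y H) y.
Proof.
move=> lim i; have [xl cl ul] := lim i; split=> [|k]; last exact: coord_cvgP.
split=> [k|j k]; apply: coord_cvgP; first exact: xl.
exact: cl.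
Qed.

Lemma stack_of_average_cvg (T : Type) (F : set_system T) {FF : Filter F}
    ys y i :
  decision_cvg F ys y ->
  stack_cvg F (fun t => stack_of (average (ys t)) i) (stack_of (average y) i).
Proof.
move=> yl.
have avg j k : coord_cvg F (fun t => average (ys t) j k) (average y j k).
  move=> r; rewrite /average !mxE; under eq_cvg do rewrite !mxE.
  apply: cvgMl_tmp; apply: cvgD; first exact: ((yl j).1.1 k r).
  rewrite summxE; under eq_cvg do rewrite summxE.
  by apply: cvg_sumf => p; exact: ((yl (sval p)).1.2 (exist _ j (svalP p)) k r).
by split=> *; exact: avg.
Qed.

Lemma residual_cvg (T : Type) (F : set_system T) {FF : Filter F} ys y i :
  decision_cvg F ys y ->
  stack_cvg F (fun t => residual (ys t) i) (residual y i).
Proof.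
move=> yl; apply: stack_cvg_sub; first exact: (yl i).1.
exact: stack_of_average_cvg.
Qed.

Lemma cost_cvg (T : Type) (F : set_system T) {FF : Filter F} ys y i :
  quadratic_costs D -> decision_cvg F ys y ->
  cost (ys t i) @[t --> F] --> cost (y i).
Proof.
move=> [Q [Phi [Ru [Qn /(_ i) [_ _ _ ellE VfE]]]]] /(_ i) [[xl cl] ul].
apply: cvgD.
  apply: cvg_sumf => k; rewrite ellE; under eq_cvg do rewrite ellE.
  apply: cvgD; last first.
    by apply: cvg_sumf => j; apply: coord_cvg_quad; exact: cl.
  apply: cvgD; apply: coord_cvg_quad; first exact: xl.
  exact: ul.
by rewrite VfE; under eq_cvg do rewrite VfE; apply: coord_cvg_quad; exact: xl.
Qed.

Context (rho : R) (Tcut : nat) (x : state D) (y0 : decision D)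
  (H : iterates D).
Context (rho0 : 0 < rho) (admmH : admm rho Tcut x y0 H).

Lemma admm_dual_update t i :
  it_lam H t.+1 i =
  stack_add (it_lam H t i) (stack_scale rho (residual (it_y H t.+1) i)).
Proof.
have [_ _ zE lamE _] := admmH.
by rewrite lamE (functional_extensionality_dep (zE t)).
Qed.

(** The multipliers start at zero and move along residuals. *)
Lemma admm_dual_orthogonal t (w : forall i, traj i) :
  stacks_dot (it_lam H t) (stack_of w) = 0.
Proof.
elim: t => [|t IHt].
  have [ini _ _ _ _] := admmH; apply: big1 => i _.
  by have [_ -> _] := ini i; exact: stack_dot0l.
rewrite /stacks_dot.
under eq_bigr do rewrite admm_dual_update stack_dotDl stack_dotZl.
by rewrite big_split -mulr_sumr /= -!/(stacks_dot _ _) IHt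
   residual_orthogonal mulr0 addr0.
Qed.

Lemma admm_switching_stationary t : (Tcut <= t)%N -> it_s H t = it_s H Tcut.
Proof.
have [_ _ _ _ sE] := admmH.
elim: t => [|t IHt]; first by rewrite leqn0 => /eqP ->.
rewrite leq_eqVlt => /predU1P[-> //|Tt].
rewrite -IHt //; apply: functional_extensionality_dep => i.
by have := sE t i; rewrite ltnNge -ltnS Tt.
Qed.

(** The consensual point [y] competes in all the local minimizations at once.
    By orthogonality the multipliers do not see [y], and on the minimizers they
    only see the residual, so that adding up the minimality inequalities bounds
    their pairing. *)
Lemma admm_dual_dot_residual t (y : decision D) : (Tcut <= t)%N ->
  Ys (it_s H Tcut) x y ->
  stacks_dot (it_lam H t) (residual (it_y H t.+1)) <=
  \sum_i (cost (y i) +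
    rho / 2 * stack_dot (stack_sub (xt (y i)) (stack_of (it_z H t) i))
                        (stack_sub (xt (y i)) (stack_of (it_z H t) i))
    - cost (it_y H t.+1 i)).
Proof.
move=> Tt [Hy cy]; have [_ argm _ _ _] := admmH.
(* The linear term vanishes at [y], whose copies are the trajectories. *)
have lamy : \sum_i stack_dot (it_lam H t i) (xt (y i)) = 0.
  rewrite -[RHS](admm_dual_orthogonal t (fun j => xs (y j))).
  by apply: eq_bigr => i _; rewrite consensus_stack_of.
have -> : stacks_dot (it_lam H t) (residual (it_y H t.+1)) =
    \sum_i stack_dot (it_lam H t i) (xt (it_y H t.+1 i)).
  rewrite /stacks_dot; under eq_bigr do rewrite stack_dotBr.
  by rewrite sumrB [X in _ - X](admm_dual_orthogonal t) subr0.
rewrite -[leRHS]addr0 -[X in _ <= _ + X]lamy -big_split ler_sum // => i _.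
have [_] := argm t i.
rewrite admm_switching_stationary // => /(_ _ (Hy i)); rewrite /aug_cost.
(* The penalty of the minimizer is nonnegative and is dropped. *)
have pen_ge0 (v : stack i) : 0 <= rho / 2 * stack_dot v v.
  by rewrite mulr_ge0 ?stack_dot_ge0 // divr_ge0 // ltW.
have := pen_ge0 (stack_sub (xt (it_y H t.+1 i)) (stack_of (it_z H t) i)).
rewrite /=; lra.
Qed.

(** If the residual did not tend to zero, the multipliers would grow linearly in
    its limit direction, against the bound of [admm_dual_dot_residual], whose
    right-hand side converges with the iterates. *)
Lemma admm_limit_consensus (y : decision D) : quadratic_costs D ->
  Ys (it_s H Tcut) x !=set0 -> admm_limit H y -> consensus y.
Proof.
move=> qc [yf Yyf] /admm_limit_cvg ylim; apply: residual0_consensus.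
have [_ _ zE _ _] := admmH.
pose r t := residual (it_y H t).
have rl i : stack_cvg \oo (fun t => r t i) (residual y i).
  exact: residual_cvg.
apply/eqP; rewrite eq_le; apply/andP; split; last first.
  by apply: sumr_ge0 => i _; exact: stack_dot_ge0.
pose b t := \sum_i (cost (yf i) +
    rho / 2 * stack_dot (stack_sub (xt (yf i)) (stack_of (it_z H t) i))
                        (stack_sub (xt (yf i)) (stack_of (it_z H t) i))
    - cost (it_y H t.+1 i)).
pose beta := \sum_i (cost (yf i) +
    rho / 2 * stack_dot (stack_sub (xt (yf i)) (stack_of (average y) i))
                        (stack_sub (xt (yf i)) (stack_of (average y) i))
    - cost (y i)).
apply: (@summands_limit_le0 _ rho _ beta
  (fun t m => stacks_dot (it_lam H t) (r m))
  (fun t m => stacks_dot (r t) (r m)) b) => //.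
- move=> t m; rewrite /stacks_dot mulr_sumr -big_split.
  by apply: eq_bigr => i _; rewrite admm_dual_update stack_dotDl stack_dotZl.
- move=> t; apply/cvg_ex; exists (stacks_dot (it_lam H t) (residual y)).
  apply: cvg_sumf => i; apply: stack_cvg_dot => //; exact: stack_cvg_cst.
- apply: cvg_sumf => i; apply: stack_cvg_dot.
    exact: (stack_cvg_comp cvg_fst (rl i)).
  exact: (stack_cvg_comp cvg_snd (rl i)).
(* The averages converge; the shift is needed as [it_z H 0] is not an
   average. *)
- have shift : n.+1 @[n --> \oo] --> \oo by exact: (cvg_addnl 1).
  have zl i :
      stack_cvg \oo (fun t => stack_of (it_z H t) i) (stack_of (average y) i).
    have zl1 : stack_cvg \oo (fun t => stack_of (it_z H t.+1) i)
        (stack_of (average y) i).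
      have -> : (fun t => stack_of (it_z H t.+1) i) =
          (fun t => stack_of (average (it_y H t)) i) \o succn.
        apply: funext => t /=.
        by rewrite (functional_extensionality_dep (zE t)).
      exact: (stack_cvg_comp shift (stack_of_average_cvg i ylim)).
    split=> [k|j k] q; rewrite -cvg_shiftS; first exact: zl1.1.
    exact: zl1.2.
  apply: cvg_sumf => i; apply: cvgB; last first.
    by rewrite (cvg_shiftS (fun t => cost (it_y H t i))); exact: cost_cvg.
  apply: cvgD; first exact: cvg_cst.
  by apply: cvgMl_tmp; apply: stack_cvg_dot; apply: stack_cvg_sub => //;
    exact: stack_cvg_cst.
- by exists Tcut => // t Tt; exact: admm_dual_dot_residual.
Qed.

End Consensus.

(** * Shifting a feasible plan *)

Section Feasibility.
Context {R : realType} (D : network R).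


Notation sub := 'I_(nsub D).
Notation N := (hor D).+1.

Implicit Types (x : state D) (y : decision D) (uh : inputs D).

Definition state_at y (k : 'I_N.+1) : state D := fun i => xs (y i) k.

Lemma consensus_copies y i k :
  consensus y -> copies (y i) k = nbrs (state_at y k) i.
Proof.
move=> cy; apply: functional_extensionality_dep => j.
by rewrite /copies cy.
Qed.

Lemma state_ext x x' : (forall i, x i = x' i) -> x = x'.
Proof. exact: functional_extensionality_dep. Qed.

Lemma state_at_next y (k : 'I_N) : dynamics y -> consensus y ->
  state_at y (next k) =
  fun i => f (state_at y (now k) i) (us (y i) k) (nbrs (state_at y (now k)) i).
Proof.
move=> dy cy; apply: state_ext => i.
by rewrite /state_at dy consensus_copies.
Qed.

Lemma exists_rollout x uh : exists y, rollout x uh y.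
Proof.
pose step (k : nat) (z : state D) : state D :=
  fun i => f (z i) (uh i (inord k)) (nbrs z i).
pose sq := fix sq (k : nat) : state D :=
  if k is k'.+1 then step k' (sq k') else x.
exists (fun i => LocalDec (stack_of (fun j (k : 'I_N.+1) => sq k j) i) (uh i)).
split=> // i k; rewrite /xs /= /step.
by rewrite inord_val.
Qed.

Lemma Ys_sub_Y s x : well_posed D -> Ys s x `<=` Y x.
Proof.
move=> wp y [Hy cy]; split=> // [i|i k]; first by have [] := Hy i.
have [_ [-> Pk]] := Hy i.
by rewrite (wp_f wp _ _ (Pk _)).
Qed.

Lemma exists_labels x : terminal_sets_ok D -> XTg x ->
  exists l : labels D, in_region x l.
Proof.
move=> ts xT.
have H i : exists l : 'I_(nreg i).+1, P l (x i).
  by have [/(_ _ (xT i)) [l _ Pl] _ _ _] := ts i; exists l.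
exists (fun i => sval (cid (H i))) => i.
exact: svalP (cid (H i)).
Qed.

Lemma terminal_invariant x (u : forall i, 'cV[R]_(dimu i)) :
  terminal_sets_ok D -> XTg x -> terminal_input x u ->
  XTg (fun i => f (x i) (u i) (nbrs x i)).
Proof.
move=> ts xT [l Pl ul] i; rewrite ul.
have [_ _ _ /(_ _ _ (xT i) (Pl i)) [_]] := ts i.
by apply=> j; exact: xT.
Qed.

Lemma Y_terminal x y : Y x y -> XTg (state_at y ord_max).
Proof. by move=> [Hy _ _] i; have [] := Hy i. Qed.

Lemma exists_shifted x y : terminal_sets_ok D -> Y x y ->
  exists uh, shifted y uh.
Proof.
move=> ts Yy; have [l Pl] := exists_labels ts (Y_terminal Yy).
exists (fun i (k : 'I_N) => if (k < hor D)%N then us (y i) (inord k.+1)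
                   else K (l i) *m xs (y i) ord_max) => i.
split=> [k k' kk'|].
  have -> : (k < hor D)%N by have := ltn_ord k'; rewrite kk' ltnS.
  by rewrite -kk' inord_val.
by exists (l i); [exact: Pl | rewrite /= ltnn].
Qed.

(** The rollout retraces [y] one step ahead and ends with one step of the
    terminal feedback.  All constraints are inherited from [y] except at that
    last step, where the terminal assumptions give them. *)
Lemma shifted_rollout_feasible x y uh y' : well_posed D ->
  terminal_sets_ok D -> terminal_coupling D -> Y x y -> shifted y uh ->
  rollout (fun i => f (x i) (us (y i) ord0) (nbrs x i)) uh y' ->
  Y (fun i => f (x i) (us (y i) ord0) (nbrs x i)) y'.
Proof.
move=> wp ts tc Yy sh [y'0 y'u dy' cy'].
have [Hy dy cy] := Yy; have yT := Y_terminal Yy.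
(* The regions chosen by the shifted guess for its last input. *)
pose l : labels D := fun i => sval (cid2 ((sh i).2)).
have Pl : in_region (state_at y ord_max) l.
  by move=> i; rewrite /l; case: cid2.
have uhT i : uh i ord_max = K (l i) *m xs (y i) ord_max.
  by rewrite /l; case: cid2.
have y0 : state_at y ord0 = x.
  by apply: state_ext => i; have [] := Hy i.
have eq_next (k : 'I_N) : state_at y' (now k) = state_at y (next k).
  case: k; elim=> [|k IHk] kN.
    have -> : now (Ordinal kN) = ord0 :> 'I_N.+1 by exact: val_inj.
    have -> : Ordinal kN = ord0 by exact: val_inj.
    rewrite state_at_next //.
    have -> : now (ord0 : 'I_N) = ord0 by exact: val_inj.
    by rewrite y0; apply: state_ext => i; exact: y'0.
  have kN' : (k < N)%N by exact: ltnW.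
  have e (j : 'I_N) : j = Ordinal kN -> now j = next (Ordinal kN').
    by move=> ->; exact: val_inj.
  rewrite (e _ erefl) state_at_next // state_at_next // IHk -(e _ erefl).
  apply: state_ext => i; rewrite y'u.
  by have [/(_ (Ordinal kN') (Ordinal kN) erefl) -> _] := sh i.
pose xT := state_at y ord_max.
have nmax : next ord_max = ord_max :> 'I_N.+1 by exact: val_inj.
have y'T : state_at y' ord_max =
    fun i => f (xT i) (K (l i) *m xT i) (nbrs xT i).
  rewrite -nmax state_at_next // eq_next nmax.
  by apply: state_ext => i; rewrite y'u uhT.
have y'XT : XTg (state_at y' ord_max).
  by rewrite y'T; apply: terminal_invariant => //; exists l.
have XTX (z : state D) : XTg z -> forall i, X i (z i).
  move=> zT i; rewrite -(wp_cover wp i).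
  by have [/(_ _ (zT i)) [l' _ Pl'] _ _ _] := ts i; exists l'.
have splitk (k : 'I_N.+1) : (exists k', k = now k') \/ k = ord_max.
  have [kN|kN] := ltnP k N; first by left; exists (Ordinal kN); exact: val_inj.
  right; apply: val_inj; apply/eqP => /=.
  by rewrite eqn_leq kN -ltnS ltn_ord.
have hy k i : h_le0 (state_at y k i) (nbrs (state_at y k) i).
  by have [/(_ k) []] := Hy i; rewrite consensus_copies.
split=> // i; split.
- move=> k; rewrite consensus_copies //.
  have [[k' ->]|->] := splitk k.
    split; first by have := hy (next k') i; rewrite -eq_next.
    have : X i (state_at y (next k') i) by have [/(_ (next k')) []] := Hy i.
    by rewrite -eq_next.
  split; last exact: (XTX _ y'XT).
  rewrite -[xs _ _]/(state_at y' ord_max i) y'T.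
  exact: (tc xT l yT Pl (hy ord_max) i).
- move=> k; rewrite y'u.
  have [kN|kN] := ltnP k.+1 N.
    have [/(_ k (Ordinal kN) erefl) -> _] := sh i.
    by have [_ /(_ (Ordinal kN))] := Hy i.
  have -> : k = ord_max.
    by apply: val_inj; apply/eqP; rewrite eqn_leq /= -ltnS ltn_ord -ltnS.
  by rewrite uhT; have [_ _ _ /(_ _ _ (yT i) (Pl i)) []] := ts i.
- exact: y'0.
- exact: y'XT.
Qed.

Lemma next_state_feasible x y : well_posed D ->
  terminal_sets_ok D -> terminal_coupling D -> Y x y ->
  X0 (fun i => f (x i) (us (y i) ord0) (nbrs x i)).
Proof.
move=> wp ts tc Yy; have [uh sh] := exists_shifted ts Yy.
have [y' ry'] :=
  exists_rollout (fun i => f (x i) (us (y i) ord0) (nbrs x i)) uh.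
by exists y'; exact: shifted_rollout_feasible ry'.
Qed.

End Feasibility.

(** * The closed loop *)

Section ClosedLoop.
Context {R : realType} {D : network R} (rho : R) (Tcut : nat)
  (C : closed_loop D).
Context (wp : well_posed D) (rho0 : 0 < rho)
  (local_feasible : no_false_local_feasibility D)
  (ts : terminal_sets_ok D) (qc : quadratic_costs D)
  (tc : terminal_coupling D).

Lemma terminal_stays t : mpc_step rho Tcut C t ->
  XTg (st C t) -> XTg (st C t.+1).
Proof.
move=> [inpT _ stS] xT; rewrite (state_ext stS).
by apply: terminal_invariant => //; exact: inpT.
Qed.

Lemma step_state t : mpc_step rho Tcut C t -> ~ XTg (st C t) ->
  st C t.+1 =
  fun i => f (st C t i) (us (plan C t i) ord0) (nbrs (st C t) i).
Proof.
move=> [_ main stS] /main[_ _ _ _ inpE].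
by apply: state_ext => i; rewrite stS inpE.
Qed.

(** The local sets of the final switching sequence contain the late
    iterates, so by the exclusion of false local feasibility they admit a consensual point,
    which is what makes the limit consensual. *)
Lemma out_feasible t : mpc_step rho Tcut C t -> limit_admissible Tcut C t ->
  ~ XTg (st C t) -> X0 (st C t) -> Y (st C t) (out C t).
Proof.
move=> [_ main _] adm nT stX.
have [_ _ [admmH lim] _ _] := main nT; have outY := adm nT.
have [_ argm _ _ _] := admmH.
apply: (Ys_sub_Y wp (s := it_s (iters C t) Tcut)); split=> //.
apply: (admm_limit_consensus rho0 admmH) => //.
apply/set0P/eqP => Y0; apply: (local_feasible stX).
exists (it_s (iters C t) Tcut); split=> // i.
by have [yY _] := argm Tcut i; exists (it_y (iters C t) Tcut.+1 i).
Qed.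

(** By induction: feasibility of the previous plan gives both the feasibility of
    the current state, on which the accepted output relies, and that of the
    rollout.  At time 0 the former is assumed, and so is the
    latter whenever the output is rejected. *)
Lemma plan_feasible t :
  X0 (st C 0) -> initial_fallback_feasible C ->
  (forall t', (t' <= t)%N -> mpc_step rho Tcut C t') ->
  (forall t', (t' <= t)%N -> limit_admissible Tcut C t') ->
  ~ XTg (st C t) -> Y (st C t) (plan C t).
Proof.
move=> st0 fb; elim: t => [|t IHt] step adm nT.
  have [_ /(_ nT) [_ _ _ -> _] _] := step 0 (leqnn _).
  have outY := out_feasible (step 0 (leqnn _)) (adm 0 (leqnn _)) nT st0.
  by case: asboolP => // nacc; case: fb.
have nT' : ~ XTg (st C t) by move=> /(terminal_stays (step t (leqnSn t))).
have planY : Y (st C t) (plan C t).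
  by apply: IHt => // t' /leqW; [exact: step | exact: adm].
have stS := step_state (step t (leqnSn t)) nT'.
have [_ /(_ nT) [sh ro _ -> _] _] := step t.+1 (leqnn _).
case: asboolP => _; last first.
  by rewrite stS in ro *; exact: shifted_rollout_feasible ro.
apply: out_feasible => //; [exact: step | exact: adm |].
by rewrite stS; exact: next_state_feasible.
Qed.

End ClosedLoop.

Theorem theorem1 (R : realType) (D : network R) (rho : R) (Tcut : nat)
    (C : closed_loop D)
    (hwp : well_posed D)
    (hrho : 0 < rho)
    (h1 : no_false_local_feasibility D)
    (h3 : linear_parts_ok D)
    (h4 : terminal_sets_ok D)
    (h5 : quadratic_costs D)
    (h5' : terminal_decrease D)
    (hx0 : X0 (st C 0)) (hx0' : ~ XTg (st C 0))
    (h6 : weakly_feasible (st C 0) (guess C 0) (it_s (iters C 0) 0))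
    (hcoupling : terminal_coupling D)
    (hfallback : initial_fallback_feasible C) :
  forall t : nat,
    (forall t' : nat, (t' < t)%N -> mpc_step rho Tcut C t') ->
    (forall t' : nat, (t' < t)%N -> limit_admissible Tcut C t') ->
    ~ XTg (st C t) ->
    Y (st C t) !=set0.
Proof.
case=> [//|t] step adm nT.
have nT' : ~ XTg (st C t) by move=> /(terminal_stays h4 (step t (leqnn _))).
rewrite (step_state (step t (leqnn _)) nT').
apply: next_state_feasible => //.
exact: (plan_feasible hwp hrho h1 h4 h5 hcoupling hx0 hfallback step adm nT').
Qed.
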